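(* Let $G$ be a connected simple graph with $n$ vertices, $m$ edges, maximum degree $\Delta$ and minimum degree $\delta$, and let $\alpha \in [0,1]$. Then $$\lambda_1(A_\alpha(G)) \leq \sqrt{\alpha^2 \big(2mn -n(n-1)\delta + 2m(\delta-1)\big) + 2m(1-\alpha)^2 + \delta\big(\alpha^2\delta+(1-\alpha)^2\big)(\Delta - n + 1)}.$$
   Context: For a graph $G$ with adjacency matrix $A(G)$ and diagonal degree matrix $D(G)$, and $\alpha\in[0,1]$, define $A_\alpha(G) = \alpha D(G) + (1-\alpha)A(G)$. Its eigenvalues are ordered $\lambda_1(A_\alpha(G)) \geq \cdots \geq \lambda_n(A_\alpha(G))$. *)

(* Defs.v *)
From mathcomp Require Import all_boot all_order all_algebra.
From mathcomp Require Import polyrcf complex.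

Set Implicit Arguments.
Unset Strict Implicit.
Unset Printing Implicit Defensive.

Import Order.TTheory GRing.Theory Num.Theory.
Local Open Scope ring_scope.

Record sgraph (T : finType) := SGraph {
  adj :> rel T;
  adj_sym : symmetric adj;
  adj_irrefl : irreflexive adj }.

Section Graph.
Variables (T : finType) (G : sgraph T).

Definition connected_graph : Prop :=
  (0 < #|T|)%N /\ forall x y : T, connect G x y.

Definition edges : {set {set T}} := [set [set x; y] | x in T, y in T & G x y].

Definition deg (x : T) : nat := #|[set y | G x y]|.

Definition max_deg : nat := \max_(x : T) deg x.

(* Every degree is smaller than #|T|, so the default value #|T| is the
   result only on the empty vertex set. *)
Definition min_deg : nat := \big[minn/#|T|]_(x : T) deg x.

Variable R : rcfType.

Definition adj_mx : 'M[R]_#|T| :=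
  \matrix_(i, j) (G (enum_val i) (enum_val j))%:R.

Definition deg_mx : 'M[R]_#|T| :=
  diag_mx (\row_i (deg (enum_val i))%:R).

Definition alpha_mx (alpha : R) : 'M[R]_#|T| :=
  alpha *: deg_mx + (1 - alpha) *: adj_mx.

Lemma tr_alpha_mx (alpha : R) : (alpha_mx alpha)^T = alpha_mx alpha.
Proof.
rewrite /alpha_mx linearD !linearZ /= tr_diag_mx; congr (_ + _ *: _).
by apply/matrixP => i j; rewrite !mxE adj_sym.
Qed.

End Graph.

(* The roots in R of the characteristic polynomial, with multiplicity, in
   nonincreasing order.  For a symmetric matrix these are all its
   eigenvalues: see char_poly_eigenvalues and size_eigenvalues. *)
Definition eigenvalues (R : rcfType) (n : nat) (A : 'M[R]_n) : seq R :=
  let p := char_poly A in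
  sort >=%O (flatten [seq nseq (mup x p) x | x <- rootsR p]).

(* lambda k A is the k-th largest eigenvalue, counted from k = 1. *)
Definition lambda (R : rcfType) (n : nat) (k : nat) (A : 'M[R]_n) : R :=
  (eigenvalues A)`_k.-1.

Section SymmetricSpectrum.
Variable R : rcfType.

Lemma mup_prod (s : seq R) (x : R) :
  mup x (\prod_(a <- s) ('X - a%:P)) = count_mem x s.
Proof.
elim: s => [|a s IHs]; first by rewrite big_nil mupNroot // root1.
rewrite big_cons mupM ?polyXsubC_eq0 //; last first.
  by rewrite monic_neq0 // monic_prod_XsubC.
by rewrite IHs -['X - a%:P]expr1 mup_XsubCX /= eq_sym; case: eqP.
Qed.

Lemma symmetric_char_poly_split (n : nat) (A : 'M[R]_n) :
  A^T = A -> exists s : seq R, char_poly A = \prod_(a <- s) ('X - a%:P).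
Proof.
move=> symA; pose f := real_complex R; pose B := map_mx f A.
have symB : B \is hermsymmx.
  apply: realsym_hermsym.
    by apply/is_hermitianmxP; rewrite expr0 scale1r map_mx_id // /B map_trmx symA.
  apply/mxOverP => i j; rewrite mxE; exact/complex_realP/ex_intro.
have /orthomx_spectralP defB := hermitian_normalmx symB.
have dR := hermitian_spectral_diag_real symB.
set d := spectral_diag B in defB dR.
exists [seq complex.Re (d 0 i) | i <- enum 'I_n].
apply: (map_poly_inj f); rewrite map_char_poly -/B.
have -> : char_poly B = char_poly (diag_mx d).
  rewrite defB /char_poly /char_poly_mx !map_mxM.
  set U := spectralmx B; have uU : U \in unitmx := spectral_unit B.
  set P := map_mx _ U; set Q := map_mx _ (invmx U); set D := map_mx _ _.
  have QP : Q *m P = 1%:M by rewrite -map_mxM mulVmx // map_mx1.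
  have -> : 'X%:M - Q *m D *m P = Q *m ('X%:M - D) *m P.
    by rewrite mulmxBr mulmxBl scalar_mxC -[_ *m Q *m P]mulmxA QP mulmx1.
  by rewrite !det_mulmx mulrAC -det_mulmx QP det1 mul1r.
rewrite char_poly_trig ?diag_mx_is_trig // big_map rmorph_prod /= big_enum /=.
apply: eq_bigr => i _; rewrite map_polyXsubC mxE eqxx mulr1n.
by have /mxOverP/(_ 0 i) /RRe_real di := dR; rewrite -{1}di.
Qed.

Lemma perm_eigenvalues (n : nat) (A : 'M[R]_n) (s : seq R) :
  char_poly A = \prod_(a <- s) ('X - a%:P) -> perm_eq (eigenvalues A) s.
Proof.
move=> defA; rewrite /eigenvalues perm_sort; set p := char_poly A.
have p0 : p != 0 by rewrite monic_neq0 // char_poly_monic.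
have ur : uniq (rootsR p).
  by apply: (sorted_uniq (@lt_trans _ _) (@lt_irreflexive _ _)); exact: sorted_roots.
have rE x : (x \in rootsR p) = root p x.
  by rewrite -(roots_on_rootsR p0).
apply/allP => x _; apply/eqP; rewrite -[RHS]mup_prod -defA -/p.
rewrite count_flatten sumnE big_map big_map.
rewrite (eq_bigr (fun y => (y == x) * mup y p)%N) => [|y _]; last first.
  by rewrite count_nseq.
have [rx|nrx] := boolP (root p x).
  rewrite (bigD1_seq x) ?rE //= eqxx mul1n big1 ?addn0 // => y /negPf -> //.
rewrite mupNroot // big1_seq // => y /=; rewrite rE.
by have [-> rx|//] := eqVneq y x; rewrite rx in nrx.
Qed.

Lemma char_poly_eigenvalues (n : nat) (A : 'M[R]_n) :
  A^T = A -> char_poly A = \prod_(a <- eigenvalues A) ('X - a%:P).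
Proof.
move=> /symmetric_char_poly_split [s defA].
by rewrite (perm_big _ (perm_eigenvalues defA)).
Qed.

Lemma size_eigenvalues (n : nat) (A : 'M[R]_n) :
  A^T = A -> size (eigenvalues A) = n.
Proof.
move=> /char_poly_eigenvalues /(congr1 (fun p : {poly R} => size p)).
by rewrite size_char_poly size_prod_XsubC => -[].
Qed.

End SymmetricSpectrum.

(* Main.v *)
Require Import Defs.
From mathcomp Require Import all_boot all_order all_algebra.
From mathcomp Require Import ring lra.

Set Implicit Arguments.
Unset Strict Implicit.
Unset Printing Implicit Defensive.

Import Order.TTheory GRing.Theory Num.Theory.
Local Open Scope ring_scope.

(** Let [x] be an eigenvector of [A = alpha_mx G alpha] for [lambda].  Row [t] of
    [A] is supported on the closed neighbourhood of [t], so Cauchy-Schwarz gives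
    [(lambda x_t)^2 <= r_t (|x|^2 - \sum_(s non-adjacent to t) x_s^2)] with
    [r_t = alpha^2 d_t^2 + (1 - alpha)^2 d_t].  Summing over [t], and bounding
    [r_t] below by its value at [delta] and the number of non-neighbours of each
    [s] below by [n - 1 - Delta], leaves
    [lambda^2 <= \sum_t r_t + delta (alpha^2 delta + (1 - alpha)^2) (Delta - n + 1)].
    Finally [\sum_t d_t^2] is bounded through
    [\sum_(y ~ x) d_y <= 2 m - d_x - (n - 1 - d_x) delta]. *)

Section CauchySchwarz.
Variables (R : realFieldType) (I : finType).

(** Lagrange's identity: the double sum of [(a i * b j - a j * b i) ^+ 2] is twice the difference of
    the two sides. *)
Lemma sum_mul_sqr_le (a b : I -> R) :
  (\sum_i a i * b i) ^+ 2 <= (\sum_i a i ^+ 2) * (\sum_i b i ^+ 2).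
Proof.
have : 0 <= \sum_i \sum_j (a i * b j - a j * b i) ^+ 2.
  by apply: sumr_ge0 => i _; apply: sumr_ge0 => j _; exact: sqr_ge0.
have -> : \sum_i \sum_j (a i * b j - a j * b i) ^+ 2 =
    \sum_i \sum_j (a i ^+ 2 * b j ^+ 2 + a j ^+ 2 * b i ^+ 2
                   - 2 * ((a i * b i) * (a j * b j))).
  by apply: eq_bigr => i _; apply: eq_bigr => j _; ring.
under eq_bigr => i _ do rewrite sumrB big_split /= -mulr_sumr -mulr_suml -!mulr_sumr.
rewrite sumrB big_split /= -mulr_suml -mulr_sumr -mulr_sumr -mulr_suml.
rewrite expr2; lra.
Qed.

End CauchySchwarz.

Section Degrees.
Variables (T : finType) (G : sgraph T).

Lemma edgesP (e : {set T}) :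
  reflect (exists x y, G x y /\ e = [set x; y]) (e \in edges G).
Proof.
apply: (iffP imset2P) => [[x y _]|[x [y [Gxy ->]]]].
  by rewrite inE => /andP[_ Gxy] ->; exists x, y.
by exists x y; rewrite ?inE.
Qed.

Lemma adj_neq x y : G x y -> x != y.
Proof. by apply: contraTneq => ->; rewrite adj_irrefl. Qed.

(** The map [y |-> [set x; y]] is injective on the neighbours of [x], and its image is the set of
    edges through [x]. *)
Lemma incident_edges_card x : #|[set e in edges G | x \in e]| = deg G x.
Proof.
rewrite /deg -(@card_in_imset _ _ (fun y => [set x; y])); last first.
  move=> y z; rewrite !inE => Gxy Gxz /setP/(_ y).
  by rewrite !inE eqxx orbT eq_sym (negPf (adj_neq Gxy)) /= => /esym/eqP.
apply: eq_card => e; rewrite inE.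
apply/andP/imsetP => [[/edgesP[a [b [Gab ->]]]]|[y]].
  rewrite !inE => /orP[] /eqP ->; first by exists b; rewrite ?inE.
  by exists a; rewrite ?inE 1?adj_sym // setUC.
by rewrite inE => Gxy ->; split; [apply/edgesP; exists x, y | rewrite !inE eqxx].
Qed.

(** Double counting of incident vertex-edge pairs; an edge has two distinct ends since [G] is
    irreflexive. *)
Lemma sum_deg : (\sum_x deg G x = 2 * #|edges G|)%N.
Proof.
under eq_bigr => x _ do rewrite -incident_edges_card -sum1_card big_mkcond.
rewrite exchange_big /= (bigID (mem (edges G))) /= [X in (_ + X)%N]big1 ?addn0.
  rewrite mulnC -sum_nat_const; apply: eq_bigr => e eE.
  have /edgesP[a [b [Gab de]]] := eE.
  have <- : #|e| = 2%N by rewrite de cards2 adj_neq.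
  under eq_bigr => x _ do rewrite inE eE /=.
  by rewrite -big_mkcond sum1_card.
by move=> e /negPf neE; rewrite big1 // => x _; rewrite inE neE.
Qed.

Lemma min_deg_le x : (min_deg G <= deg G x)%N.
Proof.
(* The iterated [minn] lies below each listed degree, whatever its default value. *)
rewrite /min_deg; have := mem_index_enum x; elim: index_enum => // y s IHs.
rewrite in_cons big_cons => /orP[/eqP <-|/IHs]; first exact: geq_minl.
exact/leq_trans/geq_minr.
Qed.

Lemma deg_le_max x : (deg G x <= max_deg G)%N.
Proof. exact: (leq_bigmax (F := deg G)). Qed.

Variable R : rcfType.

(** The 0/1 indicator of distinct non-adjacent pairs, written linearly so that sums split;
    irreflexivity keeps the subtracted terms from overlapping. *)
Definition nonadj (x y : T) : R := 1 - (x == y)%:R - (G x y)%:R.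

Lemma nonadjC x y : nonadj x y = nonadj y x.
Proof. by rewrite /nonadj eq_sym adj_sym. Qed.

Lemma nonadj_ge0 x y : 0 <= nonadj x y.
Proof.
rewrite /nonadj; case: eqVneq => [->|_]; first by rewrite adj_irrefl /=; lra.
by case: (G x y) => /=; lra.
Qed.

Lemma nonadj_compl_sqr x y : (1 - nonadj x y) ^+ 2 = 1 - nonadj x y.
Proof.
rewrite /nonadj; case: eqVneq => [->|_]; first by rewrite adj_irrefl /=; ring.
by case: (G x y) => /=; ring.
Qed.

Lemma sum_delta (f : T -> R) x : \sum_y (x == y)%:R * f y = f x.
Proof.
rewrite (bigD1 x) //= eqxx mul1r big1 ?addr0 // => y.
by rewrite eq_sym => /negPf ->; rewrite mul0r.
Qed.

Lemma sum_adj x : \sum_y (G x y)%:R = (deg G x)%:R :> R.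
Proof.
by rewrite -natr_sum /deg -sum1_card [in RHS]big_mkcond; congr _%:R;
   apply: eq_bigr => y _; rewrite inE; case: (G x y).
Qed.

Lemma sum_nonadj x : \sum_y nonadj x y = #|T|%:R - 1 - (deg G x)%:R.
Proof.
have := sum_delta (fun=> 1) x; under eq_bigr => y _ do rewrite mulr1.
by rewrite /nonadj !sumrB sum_adj sumr_const => ->.
Qed.

Lemma sum_degR : \sum_x (deg G x)%:R = 2 * #|edges G|%:R :> R.
Proof. by rewrite -natr_sum sum_deg natrM. Qed.

(** From the total degree [2m], remove [x] itself and its [n - 1 - deg G x] non-neighbours, each of
    degree at least [min_deg G]. *)
Lemma sum_neighbour_deg_le x :
  \sum_y (G x y)%:R * (deg G y)%:R <=
  2 * #|edges G|%:R - (deg G x)%:R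
    - (#|T|%:R - 1 - (deg G x)%:R) * (min_deg G)%:R :> R.
Proof.
have -> : \sum_y (G x y)%:R * (deg G y)%:R =
    2 * #|edges G|%:R - (deg G x)%:R - \sum_y nonadj x y * (deg G y)%:R :> R.
  rewrite -sum_degR -(sum_delta (fun y => (deg G y)%:R) x) -!sumrB.
  by apply: eq_bigr => y _; rewrite /nonadj; ring.
rewrite lerD2l lerN2 -sum_nonadj mulr_suml; apply: ler_sum => y _.
by rewrite ler_wpM2l ?nonadj_ge0 // ler_nat min_deg_le.
Qed.

(** Each [deg G y] occurs once per neighbour of [y] in the double sum over adjacent pairs; the
    previous bound is then summed over all vertices. *)
Lemma sum_deg_sqr_le :
  \sum_x (deg G x)%:R ^+ 2 <=
    2 * #|edges G|%:R * #|T|%:R - #|T|%:R * (#|T|%:R - 1) * (min_deg G)%:R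
    + 2 * #|edges G|%:R * ((min_deg G)%:R - 1) :> R.
Proof.
have -> : \sum_x (deg G x)%:R ^+ 2 =
    \sum_x \sum_y (G x y)%:R * (deg G y)%:R :> R.
  rewrite exchange_big /=; apply: eq_bigr => y _; rewrite -mulr_suml expr2.
  by congr (_ * _); rewrite -sum_adj; apply: eq_bigr => x _; rewrite adj_sym.
apply: le_trans (ler_sum _ (fun x _ => sum_neighbour_deg_le x)) _.
rewrite !sumrB -[X in _ - X]mulr_suml sumrB sum_degR !sumr_const.
rewrite -(mulr_natr (2 * _)) -(mulr_natr (_ - 1)).
by rewrite le_eqVlt; apply/orP; left; apply/eqP; ring.
Qed.

End Degrees.

Section AlphaMatrix.
Variables (R : rcfType) (T : finType) (G : sgraph T) (alpha : R).

Definition alpha_entry (t s : T) : R :=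
  alpha * (deg G t)%:R * (t == s)%:R + (1 - alpha) * (G t s)%:R.

(** The squared norm of row [t]; diagonal and adjacency parts have disjoint supports, so no cross
    term appears. *)
Definition row_sqr (t : T) : R :=
  alpha ^+ 2 * (deg G t)%:R ^+ 2 + (1 - alpha) ^+ 2 * (deg G t)%:R.

Lemma alpha_mxE i j :
  alpha_mx G alpha i j = alpha_entry (enum_val i) (enum_val j).
Proof.
rewrite /alpha_entry !mxE (inj_eq enum_val_inj).
by case: eqP => _; rewrite ?mulr1n ?mulr0n ?mulr1 ?mulr0.
Qed.

Lemma sum_alpha_entry_sqr t : \sum_s alpha_entry t s ^+ 2 = row_sqr t.
Proof.
rewrite /row_sqr -{2}sum_adj -(sum_delta (fun=> (deg G t)%:R ^+ 2) t).
rewrite !mulr_sumr -big_split; apply: eq_bigr => s _ /=.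
rewrite /alpha_entry; case: eqVneq => [->|_]; first by rewrite adj_irrefl /=; ring.
by case: (G t s) => /=; ring.
Qed.

Lemma alpha_entry_nonadj t s :
  alpha_entry t s * (1 - nonadj G R t s) = alpha_entry t s.
Proof.
rewrite /alpha_entry /nonadj; case: eqVneq => [->|_].
  by rewrite adj_irrefl /=; ring.
by case: (G t s) => /=; ring.
Qed.

(** [row_sqr] is nondecreasing in the degree, and the left side is its value at [min_deg G]. *)
Lemma row_sqr_ge t :
  (min_deg G)%:R * (alpha ^+ 2 * (min_deg G)%:R + (1 - alpha) ^+ 2) <= row_sqr t.
Proof.
have h : (min_deg G)%:R <= (deg G t)%:R :> R by rewrite ler_nat min_deg_le.
have h0 : 0 <= (min_deg G)%:R :> R by [].
rewrite mulrDr mulrCA -expr2 [X in _ + X]mulrC /row_sqr.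
by apply: lerD; apply: ler_wpM2l; rewrite ?sqr_ge0 ?lerXn2r ?nnegrE.
Qed.

Lemma eigenvalue_sqr_le (l : R) (x : T -> R) :
    (forall t, l * x t = \sum_s alpha_entry t s * x s) ->
    0 < \sum_t x t ^+ 2 ->
  l ^+ 2 <= \sum_t row_sqr t
    + (min_deg G)%:R * (alpha ^+ 2 * (min_deg G)%:R + (1 - alpha) ^+ 2)
      * ((max_deg G)%:R - #|T|%:R + 1).
Proof.
move=> eigx S_gt0; set c := (min_deg G)%:R * _; set S := \sum_t _ in S_gt0.
have c_ge0 : 0 <= c.
  apply: mulr_ge0 => //; apply: addr_ge0; last exact: sqr_ge0.
  by apply: mulr_ge0 => //; exact: sqr_ge0.
pose e := nonadj G R.
(* The factor [1 - e t s] is moved onto [x s] before Cauchy-Schwarz; in the subtracted term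
   [row_sqr t] is then lowered to [c]. *)
have rowle t : (l * x t) ^+ 2 <= row_sqr t * S - c * \sum_s e t s * x s ^+ 2.
  have -> : l * x t = \sum_s alpha_entry t s * ((1 - e t s) * x s).
    by rewrite eigx; apply: eq_bigr => s _; rewrite mulrA alpha_entry_nonadj.
  apply: le_trans (sum_mul_sqr_le _ _) _.
  rewrite sum_alpha_entry_sqr.
  have -> : \sum_s ((1 - e t s) * x s) ^+ 2 = S - \sum_s e t s * x s ^+ 2.
    rewrite -sumrB; apply: eq_bigr => s _.
    by rewrite exprMn nonadj_compl_sqr -/e; ring.
  rewrite mulrBr lerD2l lerN2 ler_wpM2r ?row_sqr_ge //.
  by apply: sumr_ge0 => s _; rewrite mulr_ge0 ?nonadj_ge0 ?sqr_ge0.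
rewrite -(ler_pM2r S_gt0).
have -> : l ^+ 2 * S = \sum_t (l * x t) ^+ 2.
  by rewrite mulr_sumr; apply: eq_bigr => t _; rewrite exprMn.
apply: le_trans (ler_sum _ (fun t _ => rowle t)) _.
rewrite sumrB -mulr_suml -mulr_sumr mulrDl lerD2l -[leRHS]mulrA -[leLHS]mulrN.
(* After the exchange, [x s ^+ 2] is weighted by the number of non-neighbours of [s], which is at
   least [n - 1 - Delta]. *)
rewrite ler_wpM2l // lerNl -mulNr exchange_big /= mulr_sumr; apply: ler_sum => s _.
rewrite -mulr_suml ler_wpM2r ?sqr_ge0 //.
under eq_bigr => t _ do rewrite /e nonadjC.
rewrite sum_nonadj.
have : (deg G s)%:R <= (max_deg G)%:R :> R by rewrite ler_nat deg_le_max.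
lra.
Qed.

End AlphaMatrix.

(** Since [0 < n], the list of eigenvalues is nonempty, so its head is a genuine root and not the
    default of [nth]. *)
Lemma lambda1_eigenvalue (R : rcfType) (n : nat) (A : 'M[R]_n) :
  A^T = A -> (0 < n)%N -> eigenvalue A (lambda 1 A).
Proof.
move=> symA n_gt0.
rewrite eigenvalue_root_char (char_poly_eigenvalues symA) root_prod_XsubC.
by rewrite /lambda mem_nth // size_eigenvalues.
Qed.

Theorem theorem3p3 (R : rcfType) (T : finType) (G : sgraph T) (alpha : R)
    (hG : connected_graph G) (halpha : 0 <= alpha <= 1) :
  let n : R := #|T|%:R in
  let m : R := #|edges G|%:R in
  let Delta : R := (max_deg G)%:R in
  let delta : R := (min_deg G)%:R in
  lambda 1 (alpha_mx G alpha) <=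
    Num.sqrt (alpha ^+ 2 * (2 * m * n - n * (n - 1) * delta
                              + 2 * m * (delta - 1))
              + 2 * m * (1 - alpha) ^+ 2
              + delta * (alpha ^+ 2 * delta + (1 - alpha) ^+ 2)
                  * (Delta - n + 1)).
Proof.
cbv zeta; set l := lambda 1 _.
have /eigenvalueP[v vA v0] :=
  lambda1_eigenvalue (tr_alpha_mx G alpha) (proj1 hG).
pose x t := v 0 (enum_rank t).
have eigx t : l * x t = \sum_s alpha_entry G alpha t s * x s.
  have /rowP/(_ (enum_rank t)) := vA; rewrite !mxE => <-.
  rewrite (reindex _ (onW_bij _ (@enum_rank_bij T))).
  (* [v] is a row eigenvector; symmetry of the matrix turns column sums into row sums. *)
  apply: eq_bigr => s _; rewrite -tr_alpha_mx mxE alpha_mxE !enum_rankK.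
  by rewrite mulrC.
have S_gt0 : 0 < \sum_t x t ^+ 2.
  rewrite lt_def sumr_ge0 ?andbT => [|t _]; last exact: sqr_ge0.
  apply: contra_neq v0 => /psumr_eq0P S0; apply/rowP => i; rewrite mxE.
  have /eqP := S0 (fun t _ => sqr_ge0 _) (enum_val i) isT.
  by rewrite sqrf_eq0 /x enum_valK => /eqP.
have lle := eigenvalue_sqr_le eigx S_gt0.
(* As [l <= |l| = sqrt (l ^+ 2)], a bound on [l ^+ 2] suffices. *)
apply: le_trans (ler_norm l) _; rewrite -sqrtr_sqr; apply: ler_wsqrtr.
apply: le_trans lle _; rewrite lerD2r big_split /= -!mulr_sumr sum_degR.
rewrite [X in _ + X]mulrC lerD2r ler_wpM2l ?sqr_ge0 //.
exact: sum_deg_sqr_le.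
Qed.
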